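(* Let $n\in\mathbb N$, let $\mathbf y_n=\{y_i\}_{i=1}^n\in\mathcal X^n$ be fixed observations and let $w>0$. The following two independent statements hold. 1. Consider a kernel $k$ such that $\sup_{x\in\mathcal X}k(x,x)\le\kappa<\infty$; then the kernel score posterior $\pi_{S_k}(\cdot|\mathbf y_n)$ is $C$-globally bias-robust with $$C\le8wn\kappa\,e^{6wn\kappa}\sup_{\theta\in\Theta}\pi(\theta).$$ 2. Alternatively, assume the space $\mathcal X$ is bounded such that $\sup_{x,y\in\mathcal X}\|x-y\|_2\le B<\infty$; then the energy score posterior $\pi_{S_{\mathrm E}^{(\beta)}}(\cdot|\mathbf y_n)$ is $C$-globally bias-robust with $$C\le8wnB^\beta e^{2wnB^\beta}\sup_{\theta\in\Theta}\pi(\theta).$$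
   Context: $\mathcal X\subseteq\mathbb R^d$ (data space) and $\Theta\subseteq\mathbb R^p$ (parameter space) are Borel sets; $\{P_\theta\}_{\theta\in\Theta}$ is a family of probability distributions on $\mathcal X$; $\pi$ is a prior probability density on $\Theta$. Scoring rules: for $k:\mathcal X\times\mathcal X\to\mathbb R$ a symmetric positive-definite kernel, $S_k(P,y)=\mathbb E[k(X,X')]-2\,\mathbb E[k(X,y)]$; for $\beta\in(0,2)$, $S_{\mathrm E}^{(\beta)}(P,y)=2\,\mathbb E\|X-y\|_2^\beta-\mathbb E\|X-X'\|_2^\beta$; in both, $X,X'\sim P$ are independent. For a scoring rule $S$ and a probability distribution $Q$ on $\mathcal X$, let $L(\theta,Q)=\mathbb E_{Y\sim Q}S(P_\theta,Y)$, and define the probability density on $\Theta$ $$\pi_S(\theta|Q)\propto\pi(\theta)\exp\{-wn\,L(\theta,Q)\}.$$ With $\hat P_n=\frac1n\sum_{i=1}^n\delta_{y_i}$ the empirical distribution, the scoring rule posterior is $\pi_S(\theta|\mathbf y_n)=\pi_S(\theta|\hat P_n)\propto\pi(\theta)\exp\{-w\sum_{i=1}^nS(P_\theta,y_i)\}$; the kernel and energy score posteriors correspond to $S=S_k$ and $S=S_{\mathrm E}^{(\beta)}$. For $z\in\mathcal X$ and $\epsilon\in[0,1]$, let $\hat P_{n,\epsilon,z}=(1-\epsilon)\hat P_n+\epsilon\delta_z$. The posterior influence function is $$\operatorname{PIF}(z,\theta,\hat P_n):=\left.\frac{d}{d\epsilon}\pi_S(\theta|\hat P_{n,\epsilon,z})\right|_{\epsilon=0}.$$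 The posterior is called $C$-globally bias-robust if $\sup_{\theta\in\Theta}\sup_{z\in\mathcal X}|\operatorname{PIF}(z,\theta,\hat P_n)|\le C$, for some $C<\infty$.
   Formalization: The prior density is assumed bounded, sup π(θ) < ∞; without this the claim with a finite C can fail (e.g. π(θ)=1/(2√θ) on (0,1) with Bernoulli(θ) data). *)

(* Defs.v *)
From HB Require Import structures.
From mathcomp Require Import all_boot all_order all_algebra.
From mathcomp Require Import all_classical all_reals all_analysis.
Set Implicit Arguments.
Unset Strict Implicit.
Unset Printing Implicit Defensive.
Import Order.TTheory GRing.Theory Num.Theory.
Import numFieldNormedType.Exports.
Local Open Scope classical_set_scope.
Local Open Scope ring_scope.

(* R^d; the library equips tuples with the product sigma-algebra, which is the
   Borel sigma-algebra of R^d since R is second countable. *)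
Notation euclidean R d := (d.-tuple (measurableTypeR R%type)).

Section lebesgue_step.
Context (R : realType) (n : nat).

Definition euclidean_cons (u : measurableTypeR R * euclidean R n) :
  euclidean R n.+1 := [tuple of u.1 :: u.2].

Lemma measurable_euclidean_cons : measurable_fun [set: _] euclidean_cons.
Proof. exact: measurable_cons. Qed.

Variable mu : {sigma_finite_measure set (euclidean R n) -> \bar R}.

Definition lebesgue_step : set (euclidean R n.+1) -> \bar R :=
  pushforward (@lebesgue_measure R \x mu)%E euclidean_cons.

Let lebesgue_step0 : lebesgue_step set0 = 0%E.
Proof. by rewrite /lebesgue_step /pushforward preimage_set0 measure0. Qed.

Let lebesgue_step_ge0 A : (0 <= lebesgue_step A)%E.
Proof. by rewrite /lebesgue_step /pushforward; apply: measure_ge0. Qed.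

Let lebesgue_step_sigma_additive : semi_sigma_additive lebesgue_step.
Proof.
move=> F mF tF mUF; rewrite /lebesgue_step /pushforward preimage_bigcup.
have mpre A : measurable A -> measurable (euclidean_cons @^-1` A).
  by move=> mA; rewrite -[X in measurable X]setTI; exact: measurable_euclidean_cons.
apply: measure_semi_sigma_additive.
- by move=> k; exact: mpre.
- apply/trivIsetP => /= i j _ _ ij; rewrite -preimage_setI.
  by move/trivIsetP : tF => /(_ _ _ _ _ ij) ->//; rewrite preimage_set0.
- by rewrite -preimage_bigcup; exact: mpre.
Qed.

HB.instance Definition _ := isMeasure.Build _ _ _ lebesgue_step
  lebesgue_step0 lebesgue_step_ge0 lebesgue_step_sigma_additive.

Let lebesgue_step_sigma_finite : sigma_finite setT lebesgue_step.
Proof.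
have /sigma_finiteP [F [FT ndF Foo]] := sigma_finiteT (@lebesgue_measure R).
have /sigma_finiteP [G [GT ndG Goo]] := sigma_finiteT mu.
pose uncons (t : euclidean R n.+1) : measurableTypeR R * euclidean R n :=
  (thead t, [tuple of behead t]).
have muncons : measurable_fun [set: _] uncons.
  by apply: measurable_fun_pair; [exact: measurable_tnth|exact: measurable_behead].
have consK : cancel euclidean_cons uncons.
  by case=> x t; rewrite /uncons /euclidean_cons theadE; congr (_, _); exact/val_inj.
exists (fun k => uncons @^-1` (F k `*` G k)).
  apply/seteqP; split => // t _.
  have [i _ Fi] : (\bigcup_i F i) (thead t) by rewrite -FT.
  have [j _ Gj] : (\bigcup_i G i) [tuple of behead t] by rewrite -GT.
  exists (maxn i j) => //; split => /=.
  - by move: Fi; exact/subsetPset/ndF/leq_maxl.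
  - by move: Gj; exact/subsetPset/ndG/leq_maxr.
move=> k; have [mF Fk] := Foo k; have [mG Gk] := Goo k; split.
  by rewrite -[X in measurable X]setTI; apply: muncons => //; exact: measurableX.
rewrite /lebesgue_step /pushforward.
rewrite (_ : euclidean_cons @^-1` _ = F k `*` G k); last first.
  by rewrite -comp_preimage (_ : _ \o _ = id) ?preimage_id//; exact/funext.
by rewrite product_measure1E// lte_mul_pinfty// ge0_fin_numE.
Qed.

HB.instance Definition _ := Measure_isSigmaFinite.Build _ _ _ lebesgue_step
  lebesgue_step_sigma_finite.
End lebesgue_step.

(* Lebesgue measure on R^d, as the d-fold product of the Lebesgue measure on
   R; lebesgueE below gives its value on boxes. *)
Fixpoint lebesgue (R : realType) (d : nat) :
    {sigma_finite_measure set (euclidean R d) -> \bar R} :=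
  if d is d'.+1 then lebesgue_step (lebesgue R d') else \d_([tuple]).

Lemma lebesgueE (R : realType) (d : nat) (A : 'I_d -> set (measurableTypeR R)) :
  (forall i, measurable (A i)) ->
  lebesgue R d [set t | forall i, A i (tnth t i)] =
  (\prod_(i < d) lebesgue_measure (A i))%E.
Proof.
elim: d A => [|d IH] A mA /=.
  by rewrite big_ord0 diracE mem_set// => -[].
rewrite big_ord_recl -IH; last by move=> i; exact: mA.
have mbox : measurable
    [set t : euclidean R d | forall i, A (lift ord0 i) (tnth t i)].
  rewrite [X in measurable X](_ : _ =
    \bigcap_(i in [set: 'I_d]) ((@tnth d _)^~ i @^-1` A (lift ord0 i))); last first.
    by apply/seteqP; split => t /= h i; [move=> _; exact: h|exact: h].
  apply: fin_bigcap_measurable => // i _.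
  by rewrite -[X in measurable X]setTI; exact: measurable_tnth.
rewrite -product_measure1E//= /lebesgue_step /pushforward; congr (_ _).
apply/seteqP; split => -[x t] /=.
- move=> h; split; first by have := h ord0; rewrite tnth0.
  by move=> i; have := h (lift ord0 i); rewrite tnthS.
- move=> [h0 h] i; case: (unliftP ord0 i) => [j|] ->; last by rewrite tnth0.
  by rewrite tnthS; exact: h.
Qed.

Section scoring_rules.
Context (R : realType) (d : nat).
Implicit Types (X : set (euclidean R d)) (P : probability (euclidean R d) R).

Definition dist2 (x y : euclidean R d) : R :=
  Num.sqrt (\sum_(i < d) (tnth x i - tnth y i : R) ^+ 2).

Definition pd_kernel X (k : euclidean R d -> euclidean R d -> R) : Prop :=
  (forall x y, X x -> X y -> k x y = k y x) /\
  (forall (m : nat) (x : 'I_m -> euclidean R d) (c : 'I_m -> R),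
     (forall i, X (x i)) ->
     0 <= \sum_(i < m) \sum_(j < m) c i * c j * k (x i) (x j)).

(* Distributions on X are Borel probability measures on R^d carried by X, and
   a pair of independent draws from P has law P \x P. *)
Definition kernel_score X (k : euclidean R d -> euclidean R d -> R)
    P (y : euclidean R d) : R :=
  \int[(P \x P)%E]_(u in X `*` X) k u.1 u.2 - 2 * \int[P]_(x in X) k x y.

Definition energy_score X (beta : R) P (y : euclidean R d) : R :=
  2 * \int[P]_(x in X) (dist2 x y `^ beta) -
  \int[(P \x P)%E]_(u in X `*` X) (dist2 u.1 u.2 `^ beta).

End scoring_rules.

Section empirical.
Context (R : realType) (d : nat).

Definition empirical (n : nat) (y : n.-tuple (euclidean R d)) :
    {measure set (euclidean R d) -> \bar R} :=
  mscale (n%:R^-1)%:nng (msum (fun i => \d_(nth point y i)) n).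

(* The absolute values only serve to make this a measure for every real eps;
   for eps in [0, 1] it is (1 - eps) Q + eps \d_z. *)
Definition contaminated (eps : R) (Q : {measure set (euclidean R d) -> \bar R})
    (z : euclidean R d) : {measure set (euclidean R d) -> \bar R} :=
  measure_add (mscale `|1 - eps|%:nng Q) (mscale `|eps|%:nng \d_z).

End empirical.

Definition prob_density (R : realType) (p : nat) (Theta : set (euclidean R p))
    (pi : euclidean R p -> R) : Prop :=
  [/\ measurable_fun Theta pi,
      (forall theta, Theta theta -> 0 <= pi theta) &
      (\int[lebesgue R p]_(theta in Theta) (pi theta)%:E)%E = 1%E].

Section posterior.
Context (R : realType) (d p n : nat).
Variables (X : set (euclidean R d)) (Theta : set (euclidean R p)).
Variable P : euclidean R p -> probability (euclidean R d) R.
Variable pi : euclidean R p -> R.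
Variable w : R.
Variable S : probability (euclidean R d) R -> euclidean R d -> R.

Definition expected_score (theta : euclidean R p)
    (Q : {measure set (euclidean R d) -> \bar R}) : R :=
  \int[Q]_(y in X) S (P theta) y.

Definition unnormalized_posterior (Q : {measure set (euclidean R d) -> \bar R})
    (theta : euclidean R p) : R :=
  pi theta * expR (- (w * n%:R * expected_score theta Q)).

Definition posterior (Q : {measure set (euclidean R d) -> \bar R})
    (theta : euclidean R p) : R :=
  unnormalized_posterior Q theta /
  \int[lebesgue R p]_(t in Theta) unnormalized_posterior Q t.

(* Needed for the normalising integral of the posterior to make sense; it
   holds when P is a Markov kernel. *)
Definition measurable_score : Prop :=
  forall y, X y -> measurable_fun Theta (fun theta => S (P theta) y).

(* eps ranges over [0, 1], so the derivative at 0 is the one from the right *)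
Definition PIF_quotient (z : euclidean R d) (theta : euclidean R p)
    (Q : {measure set (euclidean R d) -> \bar R}) (eps : R) : R :=
  (posterior (contaminated eps Q z) theta -
   posterior (contaminated 0 Q z) theta) / eps.

Definition PIF (z : euclidean R d) (theta : euclidean R p)
    (Q : {measure set (euclidean R d) -> \bar R}) : R :=
  lim (PIF_quotient z theta Q eps @[eps --> 0^'+]).

Definition globally_bias_robust (y : n.-tuple (euclidean R d)) (C : R) : Prop :=
  (forall z theta, X z -> Theta theta ->
     cvg (PIF_quotient z theta (empirical y) eps @[eps --> 0^'+])) /\
  (ereal_sup [set e | exists z theta,
     [/\ X z, Theta theta & e = `|PIF z theta (empirical y)|%:E]] <= C%:E)%E.

End posterior.

(* Main.v *)
(* Scores are bounded: kernel scores lie in [-3 kappa, 3 kappa] and energy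
   scores in [0, 2 B^beta].  Contaminating by z moves L along the segment
   e |-> L + e (S(., z) - L), so differentiating under the normalising integral
   gives
     PIF = w n pi_S(theta) (E_{pi_S}[S(., z) - L] - (S(., z) - L)(theta)),
   which is at most 2 w n delta e^{w n (hi - lo)} pi(theta) when scores lie in
   [lo, hi] and vary by at most delta in y.

   For beta > 1 the lower bound 0 on the energy score, that is
   E|X - X'|^beta <= 2 E|X - y|^beta, does not follow from the triangle
   inequality.  Take y = 0.  Expanding exp(2 t <X, X'>) in a power series, whose
   terms have nonnegative expectation against exp(- t |X|^2 - t |X'|^2), gives
   E exp(- t |X - X'|^2) >= (E exp(- t |X|^2))^2 >= 2 E exp(- t |X|^2) - 1,
   and integrating this against t^(- 1 - beta / 2) dt yields the claim. *)
Require Import Defs.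
From HB Require Import structures.
From mathcomp Require Import all_boot all_order all_algebra.
From mathcomp Require Import all_classical all_reals all_analysis.
From mathcomp Require Import measurable_realfun ring lra.
Set Implicit Arguments.
Unset Strict Implicit.
Unset Printing Implicit Defensive.
Import Order.TTheory GRing.Theory Num.Theory.
Import numFieldNormedType.Exports.
Local Open Scope classical_set_scope.
Local Open Scope ring_scope.

(** * Bounded measurable functions *)

Section bounded_integrable.
Context d (T : measurableType d) (R : realType).
Implicit Types (mu : {measure set T -> \bar R}) (D : set T) (f : T -> R).

Lemma bounded_integrable mu D f (M : R) : measurable D -> (mu D < +oo)%E ->
  measurable_fun D f -> (forall x, D x -> `|f x| <= M) ->
  mu.-integrable D (EFin \o f).
Proof.
move=> mD Dfin mf fM; apply: measurable_bounded_integrable => //.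
exists M; split; first exact: num_real.
by move=> N MN x /fM /le_trans; apply; exact: ltW.
Qed.

Lemma Rintegral_norm_le (P : probability T R) D f (M : R) : measurable D ->
  P D = 1%E -> measurable_fun D f -> (forall x, D x -> `|f x| <= M) ->
  `|\int[P]_(x in D) f x| <= M.
Proof.
move=> mD PD mf fM.
have Dfin : (P D < +oo)%E by rewrite PD ltry.
have intf := bounded_integrable mD Dfin mf fM.
rewrite (le_trans (le_normr_Rintegral mD intf))//.
rewrite (le_trans (@le_Rintegral _ _ _ _ _ _ (fun=> M) mD _ _ _))//.
- exact: integrable_norm.
- by apply: finite_measure_integrable_cst.
- by rewrite Rintegral_cst//= [X in fine X]PD mulr1.
Qed.

End bounded_integrable.

Section bounded_mfun.
Context d (T : measurableType d) (R : realType).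

(** This class is closed under ring operations and [expR] and is integrable against every finite
    measure, so the integrability conditions of the Gaussian and power inequalities reduce to
    closure lemmas. *)
Definition bounded_mfun (f : T -> R) : Prop :=
  measurable_fun [set: T] f /\ exists M : R, forall x, `|f x| <= M.

Implicit Types f g : T -> R.

Lemma bounded_mfun_cst (r : R) : bounded_mfun (fun=> r).
Proof. by split => //; exists `|r|. Qed.

Lemma bounded_mfunD f g : bounded_mfun f -> bounded_mfun g ->
  bounded_mfun (fun x => f x + g x).
Proof.
move=> [mf [M fM]] [mg [N gN]]; split; first exact: measurable_funD.
by exists (M + N) => x; rewrite (le_trans (ler_normD _ _))// lerD.
Qed.

Lemma bounded_mfunN f : bounded_mfun f -> bounded_mfun (fun x => - f x).
Proof.
move=> [mf [M fM]]; split; first exact: measurable_funN.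
by exists M => x; rewrite normrN.
Qed.

Lemma bounded_mfunB f g : bounded_mfun f -> bounded_mfun g ->
  bounded_mfun (fun x => f x - g x).
Proof. by move=> bf bg; apply: bounded_mfunD => //; exact: bounded_mfunN. Qed.

Lemma bounded_mfunM f g : bounded_mfun f -> bounded_mfun g ->
  bounded_mfun (fun x => f x * g x).
Proof.
move=> [mf [M fM]] [mg [N gN]]; split; first exact: measurable_funM.
by exists (M * N) => x; rewrite normrM ler_pM.
Qed.

Lemma bounded_mfunX f n : bounded_mfun f -> bounded_mfun (fun x => f x ^+ n).
Proof.
move=> [mf [M fM]]; split; first exact: measurable_funX.
by exists (M ^+ n) => x; rewrite normrX lerXn2r// nnegrE// (le_trans _ (fM x)).
Qed.

Lemma bounded_mfun_sum (I : Type) (s : seq I) (F : I -> T -> R) :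
  (forall i, bounded_mfun (F i)) -> bounded_mfun (fun x => \sum_(i <- s) F i x).
Proof.
move=> bF; elim: s => [|i s ih].
  by under eq_fun do rewrite big_nil; exact: bounded_mfun_cst.
by under eq_fun do rewrite big_cons; exact: bounded_mfunD.
Qed.

Lemma bounded_mfun_expR f : bounded_mfun f ->
  bounded_mfun (fun x => expR (f x)).
Proof.
move=> [mf [M fM]]; split; first exact: measurableT_comp.
exists (expR M) => x; rewrite ger0_norm ?expR_ge0// ler_expR.
exact: le_trans (ler_norm _) (fM x).
Qed.

Lemma bounded_mfun_integrable (mu : {measure set T -> \bar R}) f :
  (mu setT < +oo)%E -> bounded_mfun f -> mu.-integrable setT (EFin \o f).
Proof.
by move=> mufin [mf [M fM]]; exact: (bounded_integrable _ mufin mf (M := M)).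
Qed.

End bounded_mfun.

Lemma bounded_mfun_fst d d' (T : measurableType d) (T' : measurableType d')
    (R : realType) (f : T -> R) :
  bounded_mfun f -> bounded_mfun (fun u : T * T' => f u.1).
Proof. by move=> [mf [M fM]]; split; [exact: measurableT_comp|exists M]. Qed.

Lemma bounded_mfun_snd d d' (T : measurableType d) (T' : measurableType d')
    (R : realType) (f : T' -> R) :
  bounded_mfun f -> bounded_mfun (fun u : T * T' => f u.2).
Proof. by move=> [mf [M fM]]; split; [exact: measurableT_comp|exists M]. Qed.

(** * Gaussian kernels *)

Section gaussian_inequality.
Context d (T : measurableType d) (R : realType) (P : probability T R).

Lemma product_probabilityT : (P \x P)%E [set: T * T] = 1%E.
Proof.
rewrite -setXTT product_measure1E// -[RHS]mule1.
by congr (_ * _)%E; exact: probability_setT.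
Qed.

Let PP_fin : ((P \x P)%E [set: T * T] < +oo)%E.
Proof. by rewrite product_probabilityT ltry. Qed.

Let P_fin : (P [set: T] < +oo)%E.
Proof. by rewrite probability_setT ltry. Qed.

Lemma Rintegral_prod_mul (f : T -> R) : bounded_mfun f ->
  \int[(P \x P)%E]_u (f u.1 * f u.2) = (\int[P]_x f x) ^+ 2.
Proof.
move=> bf; have intf := bounded_mfun_integrable P_fin bf.
rewrite /Rintegral -integral12_prod_meas1; last first.
  apply: bounded_mfun_integrable => //; apply: bounded_mfunM.
    exact: bounded_mfun_fst.
  exact: bounded_mfun_snd.
rewrite /fubini_F/=.
under eq_integral => x _.
  under eq_integral => y _ do rewrite EFinM.
  rewrite integralZl// -(fineK (integrable_fin_num _ intf))//.
  over.
rewrite /= integralZr// -[X in (X * _)%E](fineK (integrable_fin_num _ intf))//.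
Qed.

Context (m : nat) (phi : 'I_m -> T -> R).
Hypothesis bphi : forall i, bounded_mfun (phi i).

Let dot (u : T * T) : R := \sum_i phi i u.1 * phi i u.2.

Let bdot : bounded_mfun dot.
Proof.
apply: bounded_mfun_sum => i; apply: bounded_mfunM.
  exact: bounded_mfun_fst.
exact: bounded_mfun_snd.
Qed.

Let bprod (h : T -> R) : bounded_mfun h ->
  bounded_mfun (fun u : T * T => h u.1 * h u.2).
Proof.
move=> bh; apply: bounded_mfunM.
  exact: bounded_mfun_fst.
exact: bounded_mfun_snd.
Qed.

(** Induction on [n] with the weight [h] left free: one factor [dot] expands into a sum over [i],
    and [phi i] is absorbed into the weight in both variables. At [n = 0] the integral is a
    square. *)
Lemma Rintegral_dot_pow_ge0 (n : nat) (h : T -> R) : bounded_mfun h ->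
  0 <= \int[(P \x P)%E]_u (h u.1 * h u.2 * dot u ^+ n).
Proof.
elim: n h => [|n ih] h bh.
  under eq_Rintegral do rewrite expr0 mulr1.
  by rewrite Rintegral_prod_mul// sqr_ge0.
have bhi i : bounded_mfun (fun x => h x * phi i x) by exact: bounded_mfunM.
have bi i : bounded_mfun
    (fun u => (h u.1 * phi i u.1) * (h u.2 * phi i u.2) * dot u ^+ n).
  by apply: bounded_mfunM; [exact: bprod (bhi i)|exact: bounded_mfunX].
have E u : h u.1 * h u.2 * dot u ^+ n.+1 =
    \sum_i (h u.1 * phi i u.1) * (h u.2 * phi i u.2) * dot u ^+ n.
  rewrite exprSr [X in _ * (_ * X)]/dot !mulr_sumr.
  by apply: eq_bigr => i _; ring.
under eq_Rintegral do rewrite E.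
rewrite [X in 0 <= X](_ : _ = \sum_i
    \int[(P \x P)%E]_u
      ((h u.1 * phi i u.1) * (h u.2 * phi i u.2) * dot u ^+ n)).
  by apply: sumr_ge0 => i _; exact: (ih _ (bhi i)).
(* Induction over the list of indices exchanges the finite sum with the integral. *)
elim: (index_enum _) => [|i s IH].
  under eq_Rintegral do rewrite big_nil.
  by rewrite big_nil Rintegral_cst// mul0r.
under eq_Rintegral do rewrite big_cons.
rewrite big_cons RintegralD ?IH//.
- exact: bounded_mfun_integrable (bi i).
- exact: bounded_mfun_integrable (bounded_mfun_sum _ bi).
Qed.

(** The constant term of the series yields exactly the square, so the index [n.+1] keeps at least
    that term; every further term adds a nonnegative integral by [Rintegral_dot_pow_ge0]. *)
Lemma Rintegral_dot_series_ge (n : nat) (g : T -> R) : bounded_mfun g ->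
  (\int[P]_x g x) ^+ 2 <=
  \int[(P \x P)%E]_u (g u.1 * g u.2 * series (exp_coeff (dot u)) n.+1).
Proof.
move=> bg.
have bterm k : bounded_mfun (fun u => g u.1 * g u.2 * exp_coeff (dot u) k).
  apply: bounded_mfunM; first exact: bprod.
  by apply: bounded_mfunM; [exact: bounded_mfunX|exact: bounded_mfun_cst].
have bser k :
    bounded_mfun (fun u => g u.1 * g u.2 * series (exp_coeff (dot u)) k).
  apply: bounded_mfunM; first exact: bprod.
  apply: bounded_mfun_sum => i.
  by apply: bounded_mfunM; [exact: bounded_mfunX|exact: bounded_mfun_cst].
elim: n => [|n /le_trans]; last apply.
  rewrite -Rintegral_prod_mul// le_eqVlt; apply/orP; left; apply/eqP.
  apply: eq_Rintegral => u _.
  by rewrite /series/= big_nat1 /exp_coeff/= expr0 fact0 divr1 mulr1.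
under [in leRHS]eq_Rintegral do rewrite seriesSr mulrDr.
rewrite RintegralD//; [|exact: bounded_mfun_integrable..].
rewrite lerDl.
have -> : (fun u => g u.1 * g u.2 * exp_coeff (dot u) n.+1) =
    (fun u => g u.1 * g u.2 * dot u ^+ n.+1 * (n.+1`!%:R)^-1).
  by apply/funext => u; rewrite /exp_coeff/= mulrA.
rewrite RintegralZr//; last first.
  apply: bounded_mfun_integrable => //.
  by apply: bounded_mfunM; [exact: bprod|exact: bounded_mfunX].
by rewrite mulr_ge0 ?invr_ge0 ?ler0n//; exact: Rintegral_dot_pow_ge0.
Qed.

(** Dominated convergence in [Rintegral_dot_series_ge]. The dominating constant is [N * expR M],
    with [M] a bound for [dot] and [N] one for the product of the weights. *)
Lemma Rintegral_dot_exp_ge (g : T -> R) : bounded_mfun g ->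
  (\int[P]_x g x) ^+ 2 <=
  \int[(P \x P)%E]_u (g u.1 * g u.2 * expR (dot u)).
Proof.
move=> bg; have bgg := bprod bg.
have [_ [M dotM]] := bdot; have [_ [N gN]] := bgg.
have N0 : 0 <= N by rewrite (le_trans _ (gN point)).
(* The partial sums are compared with those at the absolute value of [dot u], which increase to its
   exponential. *)
have serM n u : `|series (exp_coeff (dot u)) n| <= expR M.
  rewrite (le_trans (ler_norm_sum _ _ _))//.
  rewrite (_ : \sum_(_ <= _ < _) _ = series (exp_coeff `|dot u|) n); last first.
    apply: eq_bigr => i _.
    by rewrite /exp_coeff/= normrM normrX normfV normr_nat.
  rewrite (@le_trans _ _ (expR `|dot u|)) ?ler_expR//.
  apply: nondecreasing_cvgn_le; last exact: is_cvg_series_exp_coeff.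
  by apply: nondecreasing_series => i _ _; exact: exp_coeff_ge0.
pose f n u : R := g u.1 * g u.2 * series (exp_coeff (dot u)) n.+1.
have bf n : bounded_mfun (f n).
  apply: bounded_mfunM => //.
  apply: bounded_mfun_sum => i.
  by apply: bounded_mfunM; [exact: bounded_mfunX|exact: bounded_mfun_cst].
have /fine_cvg fcvg : (\int[(P \x P)%E]_u (f n u)%:E @[n --> \oo] -->
    (\int[(P \x P)%E]_u (g u.1 * g u.2 * expR (dot u)))%:E)%E.
  rewrite /Rintegral fineK; last first.
    apply: integrable_fin_num => //; apply: bounded_mfun_integrable => //.
    by apply: bounded_mfunM => //; exact: bounded_mfun_expR.
  apply: (@dominated_cvg _ _ _ _ _ _ _ _ (fun=> (N * expR M)%:E)) => //.
  - by move=> n; apply/measurable_EFinP; case: (bf n).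
  - move=> u _; apply: cvg_EFin; first exact: nearW.
    apply: cvgM; first exact: cvg_cst.
    have /cvg_ex[l sl] := is_cvg_series_exp_coeff (dot u).
    rewrite /expR (cvg_lim _ sl)//.
    by move: sl; rewrite -cvg_shiftS; exact.
  - exact: bounded_mfun_integrable (bounded_mfun_cst _ _).
  - by move=> n u _; rewrite lee_fin /f normrM ler_pM.
rewrite -(cvg_lim _ fcvg)//; apply: limr_ge.
  by apply/cvg_ex; eexists; exact: fcvg.
by apply: nearW => n; exact: Rintegral_dot_series_ge.
Qed.

End gaussian_inequality.

(** The complements [1 - expR] are used because they are the factor occurring in [power_kernel]. *)
Lemma Rintegral_gaussian_le d (T : measurableType d) (R : realType)
    (P : probability T R) (m : nat) (phi : 'I_m -> T -> R) :
  (forall i, bounded_mfun (phi i)) ->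
  \int[(P \x P)%E]_u (1 - expR (- \sum_i (phi i u.1 - phi i u.2) ^+ 2)) <=
  2 * \int[P]_x (1 - expR (- \sum_i phi i x ^+ 2)).
Proof.
move=> bphi; pose g x := expR (- \sum_i phi i x ^+ 2).
have bg : bounded_mfun g.
  apply/bounded_mfun_expR/bounded_mfunN/bounded_mfun_sum => i.
  exact: bounded_mfunX.
(* The factor [Num.sqrt 2] turns the product of the [psi i] into [2 * phi i u.1 * phi i u.2], the
   cross term of the squared difference. *)
pose psi i x : R := Num.sqrt 2 * phi i x.
have bpsi i : bounded_mfun (psi i).
  by apply: bounded_mfunM => //; exact: bounded_mfun_cst.
have KE u : expR (- \sum_i (phi i u.1 - phi i u.2) ^+ 2) =
    g u.1 * g u.2 * expR (\sum_i psi i u.1 * psi i u.2).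
  rewrite /g -!expRD; congr expR.
  rewrite -!sumrN -!big_split/=; apply: eq_bigr => i _.
  rewrite /psi mulrACA -expr2 sqr_sqrtr//; ring.
have := @Rintegral_dot_exp_ge _ _ _ P m psi bpsi g bg.
rewrite -(eq_Rintegral _ (fun u _ => KE u)).
have PPfin : ((P \x P)%E [set: T * T] < +oo)%E.
  by rewrite product_probabilityT ltry.
have Pfin : (P [set: T] < +oo)%E by rewrite probability_setT ltry.
rewrite RintegralB//; last 2 first.
- exact: bounded_mfun_integrable (bounded_mfun_cst _ _).
- apply: bounded_mfun_integrable => //.
  apply/bounded_mfun_expR/bounded_mfunN/bounded_mfun_sum => i.
  apply/bounded_mfunX/bounded_mfunB; first exact: bounded_mfun_fst.
  exact: bounded_mfun_snd.
rewrite RintegralB//; last 2 first.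
- exact: bounded_mfun_integrable (bounded_mfun_cst _ _).
- exact: bounded_mfun_integrable.
rewrite !Rintegral_cst//= product_probabilityT.
rewrite [X in _ <= 2 * (1 * fine X - _)](probability_setT P)/=.
(* Here [m1] is the mean of [g] and [I] the integral of the Gaussian of the difference:
   [m1 ^+ 2 <= I] and [0 <= (1 - m1) ^+ 2] give [1 - I <= 2 * (1 - m1)]. *)
set m1 := Rintegral _ _ _; set I := Rintegral _ _ _.
have := sqr_ge0 (1 - m1).
rewrite sqrrB expr1n; lra.
Qed.

(** * Powers as mixtures of exponentials *)

Section power_representation.
Context (R : realType).
Local Notation mu := (@lebesgue_measure R).

Lemma integral_lebesgue_translation (G : R -> R) (t : R) :
  continuous G -> (forall x, 0 <= G x) ->
  (\int[mu]_x (G (x + t))%:E = \int[mu]_x (G x)%:E)%E.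
Proof.
move=> cG G0; pose F (x : R) := x + t.
have dF (x : R) : is_derive x (1 : R) F (1 : R).
  by rewrite /F -[X in is_derive _ _ _ X]addr0; exact: is_deriveD.
have F'E : (F^`())%classic = cst 1.
  by apply/funext => x; rewrite derive1E derive_val.
rewrite (@increasing_ge0_integration_by_substitutionT R F G)//.
- by rewrite F'E; apply: eq_integral => x _; rewrite /= mulr1.
- by move=> x y xy; rewrite ltrD2r.
- by rewrite F'E => x; exact: cst_continuous.
- by rewrite F'E; exact: is_cvg_cst.
- by rewrite F'E; exact: is_cvg_cst.
- apply/cvgrNyPle => A; near=> x; rewrite /F -lerBrDr.
  by near: x; apply: nbhs_ninfty_le; exact: num_real.
- apply/cvgryPge => A; near=> x; rewrite /F -lerBlDr.
  by near: x; apply: nbhs_pinfty_ge; exact: num_real.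
Unshelve. all: end_near. Qed.

Lemma integral_lebesgue_oppr (f : R -> \bar R) :
  measurable_fun [set: R] f -> (forall r, 0 <= f r)%E ->
  (\int[mu]_r f (- r)%R = \int[mu]_r f r)%E.
Proof.
move=> mf f0.
transitivity (\int[pushforward mu (-%R : R -> measurableTypeR R)]_r f r)%E.
  by rewrite ge0_integral_pushforward.
by apply: eq_measure_integral => //= A mA AS; exact: lebesgue_measureN.
Qed.

(* l^a is proportional to the integral of (1 - e^{-l t}) t^{-1-a} over t > 0; in
   the variable s = ln t used here, rescaling l is a translation. *)
Definition power_kernel (a l s : R) : R :=
  expR (- (a * s)) * (1 - expR (- (l * expR s))).

Lemma power_kernel_ge0 a l s : 0 <= l -> 0 <= power_kernel a l s.
Proof.
move=> l0; rewrite mulr_ge0 ?expR_ge0// subr_ge0 -expR0 ler_expR oppr_le0.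
by rewrite mulr_ge0// expR_ge0.
Qed.

Lemma continuous_power_kernel a l : continuous (power_kernel a l).
Proof.
move=> s; apply: cvgM.
  apply: continuous_comp; last exact: continuous_expR.
  by apply: cvgN; apply: cvgM; [exact: cvg_cst|exact: cvg_id].
apply: cvgB; first exact: cvg_cst.
apply: continuous_comp; last exact: continuous_expR.
by apply: cvgN; apply: cvgM; [exact: cvg_cst|exact: continuous_expR].
Qed.

Lemma measurable_power_kernel a l :
  measurable_fun [set: R] (EFin \o power_kernel a l).
Proof.
apply/measurable_EFinP; apply: (@continuous_measurable_fun R).
exact: continuous_power_kernel.
Qed.

(** For [l > 0], [power_kernel a l s] is [l] to the power [a] times [power_kernel a 1 (s + ln l)],
    and translation preserves the integral. At [l = 0] both sides vanish. *)
Lemma integral_power_kernel a l : 0 < a -> 0 <= l ->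
  (\int[mu]_s (power_kernel a l s)%:E =
   (l `^ a)%:E * \int[mu]_s (power_kernel a 1 s)%:E)%E.
Proof.
move=> a0; rewrite le_eqVlt => /predU1P[<-|l0].
  rewrite powR0 ?gt_eqF// mul0e; apply: integral0_eq => s _.
  by rewrite /power_kernel mul0r oppr0 expR0 subrr mulr0.
rewrite -(@integral_lebesgue_translation (power_kernel a 1) (ln l));
  last 2 first.
- exact: continuous_power_kernel.
- by move=> s; exact: power_kernel_ge0.
rewrite -ge0_integralZl//=; last 3 first.
- apply/measurable_EFinP.
  apply: (@continuous_measurable_fun R (fun s => power_kernel a 1 (s + ln l))).
  move=> s.
  apply: (@continuous_comp _ _ _ (fun s : R => s + ln l) (power_kernel a 1));
    last exact: continuous_power_kernel.
  by apply: cvgD; [exact: cvg_id|exact: cvg_cst].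
- by move=> s _; rewrite lee_fin power_kernel_ge0.
- by rewrite lee_fin powR_ge0.
apply: eq_integral => s _; rewrite -EFinM; congr EFin.
rewrite /power_kernel /powR gt_eqF// mulrA -expRD mul1r (expRD s) lnK ?posrE//.
by congr (expR _ * (1 - expR _)); ring.
Qed.

(** Positivity here and finiteness in [integral_power_kernel_lty] allow this constant to be
    cancelled in [powR_le_of_laplace]. *)
Lemma integral_power_kernel_gt0 a : (0 < \int[mu]_s (power_kernel a 1 s)%:E)%E.
Proof.
have mk := measurable_power_kernel a 1.
(* A lower bound for the kernel on [[0, 1]], where [a * s] is at most the absolute value of [a] and
   [expR s] is at least 1. *)
pose k := expR (- `|a|) * (1 - expR (- 1)).
apply: (@lt_le_trans _ _ (\int[mu]_(s in `[0%R, 1%R]) k%:E)%E).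
  rewrite integral_cst//= lebesgue_measure_itv/= lte_fin ltr01 sube0 mule1.
  rewrite lte_fin.
  by rewrite mulr_gt0 ?expR_gt0// subr_gt0 -expR0 ltr_expR oppr_lt0.
apply: (@le_trans _ _ (\int[mu]_(s in `[0%R, 1%R]) (power_kernel a 1 s)%:E)%E).
  apply: ge0_le_integral => //.
  - move=> s _.
    by rewrite lee_fin mulr_ge0 ?expR_ge0// subr_ge0 expR_le1 oppr_le0 ler01.
  - exact: measurable_funTS.
  - move=> s /=; rewrite in_itv/= => /andP[s0 s1].
    rewrite lee_fin /k /power_kernel ler_pM ?expR_ge0//.
    + rewrite ler_expR lerN2 (le_trans (ler_norm _))// normrM (ger0_norm s0).
      by rewrite ler_piMr.
    + by rewrite lerB// ler_expR lerN2 mul1r leNgt expR_lt1 -leNgt.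
apply: ge0_subset_integral => //.
by move=> s _; rewrite lee_fin power_kernel_ge0.
Qed.

(** For [s >= 0] the kernel is at most [expR (- (a * s))], integrable since [a > 0]. For [s < 0],
    [1 - expR (- x) <= x] bounds it by [expR ((1 - a) * s)], integrable since [a < 1]. *)
Lemma integral_power_kernel_lty a : 0 < a < 1 ->
  (\int[mu]_s (power_kernel a 1 s)%:E < +oo)%E.
Proof.
move=> /andP[a0 a1].
have a'0 : 0 < 1 - a by rewrite subr_gt0.
(* A rescaled exponential density: it equals [expR (- (b * s))] on the half-line [s >= 0], and its
   total integral is [b^-1]. *)
pose p (b s : R) := b^-1 * exponential_pdf b s.
have p0 b s : 0 < b -> 0 <= p b s.
  by move=> b0; rewrite mulr_ge0 ?invr_ge0 ?(ltW b0) ?exponential_pdf_ge0// ltW.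
have pE b s : 0 < b -> 0 <= s -> p b s = expR (- (b * s)).
  by move=> b0 s0; rewrite /p exponential_pdfE// mulKf ?gt_eqF// mulNr.
have mp b : measurable_fun setT (EFin \o p b).
  apply/measurable_EFinP; apply: measurable_funM => //.
  exact: measurable_exponential_pdf.
have mpN b : measurable_fun [set: R] (fun s : R => (p b (- s))%:E).
  apply/measurable_EFinP; apply: (measurableT_comp (f := p b)) => //.
  exact/measurable_EFinP.
have intp b : 0 < b -> (\int[mu]_s (p b s)%:E = (b^-1)%:E)%E.
  move=> b0; under eq_integral do rewrite EFinM.
  rewrite ge0_integralZl//= ?integral_exponential_pdf ?mule1 ?lee_fin
    ?invr_ge0 ?(ltW b0)//.
  - by apply/measurable_EFinP; exact: measurable_exponential_pdf.
  - by move=> s _; rewrite lee_fin exponential_pdf_ge0// ltW.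
apply: (@le_lt_trans _ _ (\int[mu]_s ((p a s)%:E + (p (1 - a) (- s))%:E))%E).
  apply: ge0_le_integral => //.
  - by move=> s _; rewrite lee_fin power_kernel_ge0.
  - exact: measurable_power_kernel.
  - by apply: emeasurable_funD; [exact: (mp a)|exact: (mpN (1 - a))].
  - move=> s _; rewrite -EFinD lee_fin.
    have [s0|/ltW s0] := leP 0 s.
      rewrite pE// -[leLHS]addr0 lerD ?p0//.
      by rewrite ler_piMr ?expR_ge0// lerBlDr lerDl expR_ge0.
    rewrite (pE (1 - a)) ?oppr_ge0// -[leLHS]add0r lerD ?p0//.
    rewrite (_ : - ((1 - a) * - s) = - (a * s) + s); last by ring.
    rewrite expRD ler_wpM2l ?expR_ge0// mul1r.
    by have := expR_ge1Dx (- expR s); lra.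
rewrite ge0_integralD//; last 4 first.
- by move=> s _; rewrite lee_fin p0.
- exact: (mp a).
- by move=> s _; rewrite lee_fin p0.
- exact: mpN.
rewrite intp// (integral_lebesgue_oppr (mp (1 - a))); last first.
  by move=> s; rewrite lee_fin p0.
by rewrite intp// -EFinD ltry.
Qed.

End power_representation.

(** With this instance, results about one probability measure also apply to the law of an
    independent pair. *)
HB.instance Definition _ d (T : measurableType d) (R : realType)
    (P : probability T R) :=
  Measure_isProbability.Build _ _ _ (P \x P)%E (product_probabilityT P).

(** * Comparing moments through Laplace transforms *)

Lemma measurable_power_kernel2 (R : realType) d (T : measurableType d)
    (a : R) (D : T -> R) :
  measurable_fun [set: T] D ->
  measurable_fun [set: T * R] (fun u => (power_kernel a (D u.1) u.2)%:E).
Proof.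
move=> mD; apply/measurable_EFinP; apply: measurable_funM.
  apply: measurableT_comp => //; apply: measurable_funN.
  by apply: measurable_funM.
apply: measurable_funB => //; apply: measurableT_comp => //.
apply: measurable_funN; apply: measurable_funM; apply: measurableT_comp => //.
Qed.

(** Each power is replaced by its mixture of exponentials; nonnegativity of the kernel lets Tonelli
    exchange the integrals. *)
Lemma integral_powR_tonelli (R : realType) d (T : measurableType d)
    (Q : probability T R) (a : R) (D : T -> R) :
  0 < a -> measurable_fun [set: T] D -> (forall x, 0 <= D x) ->
  (\int[Q]_x (D x `^ a)%:E *
     \int[@lebesgue_measure R]_s (power_kernel a 1 s)%:E =
   \int[@lebesgue_measure R]_s \int[Q]_x (power_kernel a (D x) s)%:E)%E.
Proof.
move=> a0 mD D0.
rewrite -ge0_integralZr//; last 3 first.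
- by apply/measurable_EFinP; apply: (measurableT_comp (f := @powR R ^~ a)).
- by move=> x _; rewrite lee_fin powR_ge0.
- by apply: integral_ge0 => s _; rewrite lee_fin power_kernel_ge0.
under eq_integral do rewrite -integral_power_kernel//.
apply: (@fubini_tonelli _ _ _ _ _ Q (@lebesgue_measure R)
  (fun u : T * measurableTypeR R => (power_kernel a (D u.1) u.2)%:E)).
- exact: measurable_power_kernel2.
- by move=> u; rewrite lee_fin power_kernel_ge0.
Qed.

Lemma bounded_mfun_powR (R : realType) d (T : measurableType d) (a : R)
    (f : T -> R) : 0 <= a -> (forall x, 0 <= f x) ->
  bounded_mfun f -> bounded_mfun (fun x => f x `^ a).
Proof.
move=> a0 f0 [mf [M fM]]; split.
  by apply: (measurableT_comp (f := @powR R ^~ a)).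
exists (M `^ a) => x; rewrite ger0_norm ?powR_ge0//.
have fxM := le_trans (ler_norm _) (fM x).
by rewrite ge0_ler_powR// nnegrE// (le_trans (f0 x)).
Qed.

Lemma bounded_mfun_probability_integrable (R : realType) d
    (T : measurableType d) (P : probability T R) (f : T -> R) :
  bounded_mfun f -> P.-integrable setT (EFin \o f).
Proof.
have Pfin : (P setT < +oo)%E by rewrite probability_setT ltry.
exact: bounded_mfun_integrable.
Qed.

(** The hypothesis at [t = expR s] is integrated over [s] against the positive weight
    [expR (- (a * s))]. Both sides become moments times the same constant [L], which is positive and
    finite and cancels. *)
Lemma powR_le_of_laplace (R : realType) d1 d2 (T1 : measurableType d1)
    (T2 : measurableType d2) (Q1 : probability T1 R) (Q2 : probability T2 R)
    (f1 : T1 -> R) (f2 : T2 -> R) (b a : R) : 0 < a < 1 -> 0 <= b ->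
  bounded_mfun f1 -> (forall x, 0 <= f1 x) ->
  bounded_mfun f2 -> (forall x, 0 <= f2 x) ->
  (forall t, 0 <= t -> \int[Q1]_x (1 - expR (- (t * f1 x))) <=
                       b * \int[Q2]_x (1 - expR (- (t * f2 x)))) ->
  \int[Q1]_x (f1 x `^ a) <= b * \int[Q2]_x (f2 x `^ a).
Proof.
move=> a01 b0 bf1 f10 bf2 f20 f12; have /andP[a0 a1] := a01.
have intE d' (T' : measurableType d') (Q : probability T' R) (f : T' -> R) :
    bounded_mfun f -> (\int[Q]_x (f x)%:E)%E = (\int[Q]_x f x)%:E.
  move=> bf; rewrite /Rintegral fineK//; apply: integrable_fin_num => //.
  exact: bounded_mfun_probability_integrable.
have kE d' (T' : measurableType d') (Q : probability T' R) (f : T' -> R) s :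
    bounded_mfun f -> (\int[Q]_x (power_kernel a (f x) s)%:E)%E =
    (expR (- (a * s)) * \int[Q]_x (1 - expR (- (expR s * f x))))%:E.
  move=> bf; have bk : bounded_mfun (fun x => 1 - expR (- (f x * expR s))).
    apply: bounded_mfunB; first exact: bounded_mfun_cst.
    apply/bounded_mfun_expR/bounded_mfunN/bounded_mfunM => //.
    exact: bounded_mfun_cst.
  rewrite intE; last by apply: bounded_mfunM => //; exact: bounded_mfun_cst.
  rewrite (RintegralZl _ measurableT
    (bounded_mfun_probability_integrable Q bk)).
  by under [in RHS]eq_Rintegral do rewrite mulrC.
pose L := (\int[@lebesgue_measure R]_s (power_kernel a 1 s)%:E)%E.
have L0 : (0 < L)%E by exact: integral_power_kernel_gt0.
have Loo : (L < +oo)%E by exact: integral_power_kernel_lty.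
have Lfin : L \is a fin_num by rewrite ge0_fin_numE//; exact: ltW.
have TE d' (T' : measurableType d') (Q : probability T' R) (f : T' -> R) :
    bounded_mfun f -> (forall x, 0 <= f x) ->
    ((\int[Q]_x (f x `^ a)) * fine L)%:E =
    (\int[@lebesgue_measure R]_s \int[Q]_x (power_kernel a (f x) s)%:E)%E.
  move=> bf f0; have [mf _] := bf.
  rewrite -integral_powR_tonelli// intE.
    by rewrite EFinM (fineK Lfin); exact: erefl.
  by apply: bounded_mfun_powR => //; exact: ltW.
have mk d' (T' : measurableType d') (Q : probability T' R) (f : T' -> R) :
    bounded_mfun f -> (forall x, 0 <= f x) ->
    measurable_fun [set: R] (fun s => \int[Q]_x (power_kernel a (f x) s)%:E)%E.
  move=> [mf _] f0; apply: (measurable_fun_fubini_tonelli_G (m1 := Q)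
    (fun u : T' * measurableTypeR R => (power_kernel a (f u.1) u.2)%:E)).
    exact: measurable_power_kernel2.
  by move=> u; rewrite lee_fin power_kernel_ge0.
have k0 d' (T' : measurableType d') (Q : probability T' R) (f : T' -> R) s :
    (forall x, 0 <= f x) -> (0 <= \int[Q]_x (power_kernel a (f x) s)%:E)%E.
  by move=> f0; apply: integral_ge0 => x _; rewrite lee_fin power_kernel_ge0.
rewrite -(ler_pM2r (_ : 0 < fine L)) ?fine_gt0 ?L0// -lee_fin.
rewrite -mulrA [leRHS]EFinM.
rewrite !TE// -ge0_integralZl//; last 2 first.
- exact: mk.
- by move=> s _; exact: k0.
apply: ge0_le_integral => //.
- by move=> s _; exact: k0.
- exact: mk.
- by apply: measurable_funeM; exact: mk.
- move=> s _; rewrite !kE// -EFinM lee_fin mulrCA ler_wpM2l ?expR_ge0//.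
  by apply: f12; exact: expR_ge0.
Qed.

Lemma power_distance_le (R : realType) d (T : measurableType d)
    (P : probability T R) (m : nat) (phi : 'I_m -> T -> R) (a : R) :
  0 < a < 1 -> (forall i, bounded_mfun (phi i)) ->
  \int[(P \x P)%E]_u ((\sum_i (phi i u.1 - phi i u.2) ^+ 2) `^ a) <=
  2 * \int[P]_x ((\sum_i phi i x ^+ 2) `^ a).
Proof.
move=> a01 bphi.
apply: (@powR_le_of_laplace R _ _ _ _ (P \x P)%E P) => //.
- apply: bounded_mfun_sum => i; apply/bounded_mfunX/bounded_mfunB.
    exact: bounded_mfun_fst.
  exact: bounded_mfun_snd.
- by move=> u; apply: sumr_ge0 => i _; exact: sqr_ge0.
- by apply: bounded_mfun_sum => i; exact: bounded_mfunX.
- by move=> u; apply: sumr_ge0 => i _; exact: sqr_ge0.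
(* Rescaling the features by [Num.sqrt t] multiplies every sum of squares by [t], so the Gaussian
   inequality covers every Laplace parameter. *)
move=> t t0; pose psi i x := Num.sqrt t * phi i x.
have bpsi i : bounded_mfun (psi i).
  by apply: bounded_mfunM => //; exact: bounded_mfun_cst.
have := @Rintegral_gaussian_le _ _ _ P m psi bpsi.
have DE u : \sum_i (psi i u.1 - psi i u.2) ^+ 2 =
    t * \sum_i (phi i u.1 - phi i u.2) ^+ 2.
  rewrite mulr_sumr; apply: eq_bigr => i _.
  by rewrite -mulrBr exprMn sqr_sqrtr.
have NE x : \sum_i psi i x ^+ 2 = t * \sum_i phi i x ^+ 2.
  by rewrite mulr_sumr; apply: eq_bigr => i _; rewrite exprMn sqr_sqrtr.
under eq_Rintegral do rewrite DE.
under [X in _ <= _ * X -> _]eq_Rintegral do rewrite NE.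
exact.
Qed.

(** * The posterior under contamination *)

Lemma integral_contaminated_ge0 (R : realType) (d n : nat)
    (X : set (euclidean R d)) (y : n.-tuple (euclidean R d)) (eps : R)
    (z : euclidean R d) (f : euclidean R d -> R) :
  measurable X -> (forall i, X (tnth y i)) -> X z ->
  measurable_fun X f -> (forall x, X x -> 0 <= f x) ->
  (\int[contaminated eps (empirical y) z]_(x in X) (f x)%:E)%E =
  (`|1 - eps| * (n%:R^-1 * \sum_(i < n) f (tnth y i)) + `|eps| * f z)%:E.
Proof.
move=> mX yX zX mf f0.
have mEf : measurable_fun X (EFin \o f) by exact/measurable_EFinP.
have Ef0 x : X x -> (0 <= (f x)%:E)%E by move=> Xx; rewrite lee_fin f0.
rewrite ge0_integral_measure_add// !ge0_integral_mscale//=.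
rewrite ge0_integral_measure_sum// integral_dirac// diracE mem_set// mul1e.
rewrite (eq_bigr (fun i : 'I_n => (f (tnth y i))%:E)); last first.
  move=> i _; rewrite integral_dirac// -tnth_nth diracE mem_set ?mul1e//.
by rewrite sumEFin -!EFinM -EFinD.
Qed.

(** The measure is a finite combination of point masses, so the positive and negative parts both
    have finite integrals and may be subtracted. *)
Lemma Rintegral_contaminated (R : realType) (d n : nat)
    (X : set (euclidean R d)) (y : n.-tuple (euclidean R d)) (eps : R)
    (z : euclidean R d) (f : euclidean R d -> R) :
  measurable X -> (forall i, X (tnth y i)) -> X z -> measurable_fun X f ->
  \int[contaminated eps (empirical y) z]_(x in X) f x =
  `|1 - eps| * (n%:R^-1 * \sum_(i < n) f (tnth y i)) + `|eps| * f z.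
Proof.
move=> mX yX zX mf; rewrite /Rintegral integralE.
have pE : ((fun x => (f x)%:E)^\+)%E = EFin \o f^\+ by exact: (funerpos f).
have nE : ((fun x => (f x)%:E)^\-)%E = EFin \o f^\- by exact: (funerneg f).
rewrite pE nE /comp !integral_contaminated_ge0//; last 2 first.
- exact: measurable_funrneg.
- exact: measurable_funrpos.
have fE x : f x = f^\+ x - f^\- x by rewrite -[in LHS](funrposBneg f).
rewrite [in RHS](fE z) (eq_bigr _ (fun (i : 'I_n) _ => fE (tnth y i))) sumrB /=.
ring.
Qed.

(** * Differentiating a posterior whose exponent moves along a line *)

Section posterior_path.
Context d (T : measurableType d) (R : realType).
Variables (mu : {measure set T -> \bar R}) (Theta : set T) (prior : T -> R).
Variables (a b : T -> R) (lo hi delta : R).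
Hypothesis mTheta : measurable Theta.
Hypothesis prior_ge0 : forall t, Theta t -> 0 <= prior t.
Hypothesis int_prior : mu.-integrable Theta (EFin \o prior).
Hypothesis prior1 : \int[mu]_(t in Theta) prior t = 1.
Hypothesis ma : measurable_fun Theta a.
Hypothesis mb : measurable_fun Theta b.
Hypothesis a_itv : forall t, Theta t -> lo <= a t <= hi.
Hypothesis b_bnd : forall t, Theta t -> `|b t| <= delta.

(** The unnormalised posterior along the contamination path: [a] stands for [w n] times the
    empirical mean score, and [b] for the velocity of the exponent as mass moves to [z]. *)
Let F (e : R) (t : T) : R := prior t * expR (- (a t + e * b t)).

Let mF e : measurable_fun Theta (F e).
Proof.
apply: measurable_funM; first exact/measurable_EFinP/(measurable_int mu).
apply: measurableT_comp => //; apply: measurable_funN.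
apply: measurable_funD => //.
exact: measurable_funM.
Qed.

Let F_le e t : Theta t -> `|F e t| <= prior t * expR (- lo + `|e| * delta).
Proof.
move=> Tt; rewrite normrM (ger0_norm (prior_ge0 Tt)) ger0_norm ?expR_ge0//.
rewrite ler_wpM2l ?prior_ge0// ler_expR opprD lerD//.
  by rewrite lerN2; case/andP: (a_itv Tt).
rewrite (le_trans (ler_norm _))// normrN normrM ler_wpM2l//.
exact: b_bnd.
Qed.

Let int_bnd (f : T -> R) (c : R) : measurable_fun Theta f ->
  (forall t, Theta t -> `|f t| <= prior t * c) ->
  mu.-integrable Theta (EFin \o f).
Proof.
move=> mf fc.
apply: (@le_integrable _ _ _ mu _ mTheta _ (fun t => (prior t * c)%:E)).
- exact/measurable_EFinP.
- by move=> t Tt /=; rewrite lee_fin (le_trans (fc _ Tt))// ler_norm.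
- by under eq_fun do rewrite EFinM muleC; exact: integrableZl.
Qed.

Let int_F e : mu.-integrable Theta (EFin \o F e).
Proof. exact: (int_bnd (mF e) (F_le e)). Qed.

Let Z (e : R) : R := \int[mu]_(t in Theta) F e t.

Let Z0_ge : expR (- hi) <= Z 0.
Proof.
rewrite -[leLHS]mulr1 -prior1 -RintegralZl//; apply: le_Rintegral => //.
- exact: (integrableZl mTheta (expR (- hi)) int_prior).
- move=> t Tt; rewrite /F mul0r addr0 mulrC ler_wpM2l ?prior_ge0//.
  by rewrite ler_expR lerN2; case/andP: (a_itv Tt).
Qed.

Let Z0_gt0 : 0 < Z 0.
Proof. exact: lt_le_trans (expR_gt0 _) Z0_ge. Qed.

Let dF e t : is_derive e (1 : R) (F ^~ t) (- b t * F e t).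
Proof.
have dg : is_derive e (1 : R) (fun e : R => - (a t + e * b t)) (- b t).
  rewrite (_ : (fun e => _) = (fun e : R => - a t + (- b t) * e)); last first.
    by apply/funext => x; ring.
  have h1 := is_derive_cst (- a t : R) e (1 : R).
  have h2 := is_deriveZ (- b t) (is_derive_id e (1 : R)).
  have h3 := is_deriveD h1 h2.
  move: h3; rewrite add0r /GRing.scale/= mulr1.
  exact.
have dexp := @is_derive1_comp R expR _ e _ _ (is_derive_expR _) dg.
have := is_deriveZ (prior t) dexp.
rewrite (_ : prior t *: _ = - b t * F e t); last first.
  by rewrite /F /GRing.scale/=; ring.
exact.
Qed.

Let Z' : R := \int[mu]_(t in Theta) (- b t * F 0 t).

(** Differentiation under the integral on []-1, 1[], where the bound [F_le] becomes uniform in [e].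
    The point [t0] supplies [0 <= delta]. *)
Let dZ (t0 : T) : Theta t0 -> is_derive (0 : R) (1 : R) Z Z'.
Proof.
move=> Tt0.
have delta0 : 0 <= delta by rewrite (le_trans _ (b_bnd Tt0)).
have I0 : (`]-1, 1[%classic : set R) 0 by rewrite /= in_itv/= ltrN10 ltr01.
pose c := delta * expR (- lo + delta).
have c0 : 0 <= c by rewrite mulr_ge0// expR_ge0.
(* The absolute value keeps [G] nonnegative off [Theta], where the sign of [prior] is unknown. *)
pose G t := `|prior t| * c.
have G0 t : 0 <= G t by rewrite mulr_ge0.
have intG : mu.-integrable Theta (EFin \o G).
  apply: (int_bnd (c := c)) => [|t Tt].
    apply: measurable_funM => //; apply: measurableT_comp => //.
    exact/measurable_EFinP/(measurable_int mu).
  by rewrite ger0_norm// /G ger0_norm// prior_ge0.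
have derF x t : (`]-1, 1[%classic : set R) x -> Theta t ->
    derivable (F ^~ t) x 1 by move=> _ _; case: (dF x t).
have d1F x t : partial1of2 F x t = - b t * F x t.
  by rewrite partial1of2E; case: (dF x t).
have F_ub x t : (`]-1, 1[%classic : set R) x -> Theta t ->
    `|partial1of2 F x t| <= G t.
  rewrite /= in_itv/= => /andP[x1 x2] Tt; rewrite d1F normrM normrN /G /c.
  rewrite (ger0_norm (prior_ge0 Tt)) mulrCA ler_pM//; first exact: b_bnd.
  rewrite (le_trans (F_le _ Tt))// ler_wpM2l ?prior_ge0// ler_expR lerD2l.
  by rewrite ler_piMl// ler_norml !ltW.
apply: DeriveDef.
  exact: (derivable_under_integral mTheta I0 (fun x _ => int_F x)
    derF G0 intG F_ub).
rewrite -derive1E (differentiation_under_integral mTheta I0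
  (fun x _ => int_F x) derF G0 intG F_ub).
by apply: eq_Rintegral => t _; exact: d1F.
Qed.

(** Divided by [Z 0], [Z'] is the posterior mean of [- b], which inherits the bound on [b]. *)
Let Z'_le (t0 : T) : Theta t0 -> `|Z'| <= delta * Z 0.
Proof.
move=> Tt0.
have delta0 : 0 <= delta by rewrite (le_trans _ (b_bnd Tt0)).
have F0 t : Theta t -> 0 <= F 0 t.
  by move=> Tt; rewrite mulr_ge0 ?expR_ge0 ?prior_ge0.
have ibF : mu.-integrable Theta (EFin \o (fun t => - b t * F 0 t)).
  apply: (int_bnd (c := delta * expR (- lo + `|0| * delta))) => [|t Tt].
    by apply: measurable_funM => //; exact: measurable_funN.
  rewrite normrM normrN mulrCA; apply: ler_pM => //; first exact: b_bnd.
  exact: F_le.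
rewrite (le_trans (le_normr_Rintegral mTheta ibF))// -RintegralZl//.
apply: le_Rintegral => //.
- exact: integrable_norm.
- exact: (integrableZl mTheta delta (int_F 0)).
- move=> t Tt; rewrite normrM normrN (ger0_norm (F0 _ Tt)).
  by rewrite ler_wpM2r ?F0 ?b_bnd.
Qed.

(** The quotient rule gives the posterior density at [t] times [- b t - Z' / Z 0]. Both terms are at
    most [delta] in absolute value, hence the factor 2. *)
Lemma posterior_path_cvg (t : T) : Theta t ->
  exists2 D : R, (F e t / Z e - F 0 t / Z 0) / e @[e --> 0^'+] --> D &
    `|D| <= 2 * delta * expR (hi - lo) * prior t.
Proof.
move=> Tt; have dZt := dZ Tt.
have Z0n0 : Z 0 != 0 by rewrite gt_eqF.
have dV : is_derive (0 : R) (1 : R) (fun e => (Z e)^-1) (- (Z 0) ^- 2 *: Z').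
  case: dZt => dZ1 dZ2; apply: DeriveDef; first exact: derivableV.
  by rewrite deriveV// dZ2.
have dP := is_deriveM (dF 0 t) dV.
set D := (X in is_derive _ _ _ X) in dP.
have DE : D = F 0 t / Z 0 * (- b t - Z' / Z 0).
  by rewrite /D /GRing.scale/=; field.
exists D.
  (* The derivative is a two-sided limit, which is restricted to [e > 0]. *)
  have [/cvg_ex[l] dl] := dP; rewrite /derive => lD.
  move: dl lD => /= dl; rewrite (cvg_lim _ dl)// => lD; rewrite lD in dl.
  apply: cvg_dnbhs_at_right; move: dl.
  under eq_fun do rewrite /shift /= addr0 /GRing.scale/= mulr1 mulrC.
  exact.
have delta0 : 0 <= delta by rewrite (le_trans _ (b_bnd Tt)).
rewrite DE normrM.
rewrite [leRHS](_ : _ = expR (hi - lo) * prior t * (delta + delta));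
  last by ring.
apply: ler_pM => //.
  (* The posterior density is at most [expR (hi - lo)] times the prior:
     [F 0 t <= prior t * expR (- lo)], while [Z0_ge] gives [1 <= expR hi * Z 0]. *)
  rewrite normrM normfV (gtr0_norm Z0_gt0) ler_pdivrMr//.
  rewrite (le_trans (F_le _ Tt))// normr0 mul0r addr0 (mulrC (expR (hi - lo))).
  rewrite -mulrA ler_wpM2l ?prior_ge0//.
  rewrite expRD mulrAC ler_peMl ?expR_ge0//.
  by rewrite -(expRxMexpNx_1 hi) ler_wpM2l ?expR_ge0.
rewrite (le_trans (ler_normB _ _))// normrN lerD ?b_bnd//.
by rewrite normrM normfV (gtr0_norm Z0_gt0) ler_pdivrMr//; exact: Z'_le Tt.
Qed.

End posterior_path.

Lemma mean_itv (R : realType) (n : nat) (f : 'I_n -> R) (lo hi : R) :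
  (0 < n)%N -> (forall i, lo <= f i <= hi) ->
  lo <= n%:R^-1 * \sum_(i < n) f i <= hi.
Proof.
move=> n0 fb; have n0R : 0 < n%:R :> R by rewrite ltr0n.
have sumE (c : R) : c * n%:R = \sum_(i < n) c.
  by rewrite sumr_const card_ord mulr_natr.
rewrite mulrC ler_pdivlMr// ler_pdivrMr// !sumE.
by apply/andP; split; apply: ler_sum => i _; case/andP: (fb i).
Qed.

(** * Bias-robustness for scores with bounded range and oscillation *)

Section bounded_score.
Context (R : realType) (d p n : nat).
Variables (X : set (euclidean R d)) (Theta : set (euclidean R p)).
Variable P : euclidean R p -> probability (euclidean R d) R.
Variables (pi : euclidean R p -> R) (y : n.-tuple (euclidean R d)) (w : R).
Variable S : probability (euclidean R d) R -> euclidean R d -> R.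
Variables lo hi delta : R.
Hypotheses (mX : measurable X) (mTheta : measurable Theta).
Hypothesis pi_density : prob_density Theta pi.
Hypothesis pi_bounded :
  (ereal_sup [set (pi theta)%:E | theta in Theta] < +oo)%E.
Hypothesis n_gt0 : (0 < n)%N.
Hypothesis y_in_X : forall i, X (tnth y i).
Hypothesis w_gt0 : 0 < w.
Hypothesis mS : measurable_score X Theta P S.
Hypothesis mSX : forall theta, Theta theta -> measurable_fun X (S (P theta)).
Hypothesis S_itv : forall theta x, Theta theta -> X x ->
  lo <= S (P theta) x <= hi.
Hypothesis S_dist : forall theta x x', Theta theta -> X x -> X x' ->
  `|S (P theta) x - S (P theta) x'| <= delta.

Let mean_score (theta : euclidean R p) : R :=
  n%:R^-1 * \sum_(i < n) S (P theta) (tnth y i).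

Let wn_gt0 : 0 < w * n%:R. Proof. by rewrite mulr_gt0// ltr0n. Qed.

Let path_exponent z theta : R := w * n%:R * (S (P theta) z - mean_score theta).

Let mmean : measurable_fun Theta mean_score.
Proof.
apply: measurable_funM => //.
by apply: measurable_sum => i; exact: mS.
Qed.

(** On [[0, 1]] the absolute values in [contaminated] disappear, so the exponent is affine in [e]
    and has the shape studied in [posterior_path]. *)
Let unnormalizedE z theta e : X z -> Theta theta -> 0 <= e <= 1 ->
  unnormalized_posterior n X P pi w S (contaminated e (empirical y) z) theta =
  pi theta * expR (- (w * n%:R * mean_score theta + e * path_exponent z theta)).
Proof.
move=> zX Tt /andP[e0 e1].
rewrite /unnormalized_posterior /expected_score Rintegral_contaminated//;
  last exact: mSX.
rewrite (ger0_norm e0) ger0_norm ?subr_ge0// -/(mean_score _) /path_exponent.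
by congr (_ * expR _); ring.
Qed.

Let mean_score_itv theta : Theta theta -> lo <= mean_score theta <= hi.
Proof. by move=> Tt; apply: mean_itv => // i; exact: S_itv. Qed.

(** The score at [z] minus the mean score is the mean of the differences with the scores at the
    observations, each at most [delta]. *)
Let path_exponent_bnd z theta : X z -> Theta theta ->
  `|path_exponent z theta| <= w * n%:R * delta.
Proof.
move=> zX Tt; rewrite normrM gtr0_norm// ler_pM2l//.
have -> : S (P theta) z - mean_score theta =
    n%:R^-1 * \sum_(i < n) (S (P theta) z - S (P theta) (tnth y i)).
  rewrite sumrB sumr_const card_ord mulrBr -(mulr_natl (S _ _)) mulKf//.
  by rewrite pnatr_eq0 -lt0n.
rewrite ler_norml; apply: mean_itv => // i; rewrite -ler_norml.
exact: S_dist.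
Qed.

(** This is [posterior_path_cvg] with [lo], [hi] and [delta] multiplied by [w * n%:R]; the prior
    value is then replaced by its supremum. *)
Lemma bounded_score_bias_robust :
  globally_bias_robust X Theta P pi w S y
    (2 * (w * n%:R * delta) * expR (w * n%:R * hi - w * n%:R * lo) *
     fine (ereal_sup [set (pi theta)%:E | theta in Theta])).
Proof.
have [mpi pi0 pi1] := pi_density.
pose C1 := 2 * (w * n%:R * delta) * expR (w * n%:R * hi - w * n%:R * lo).
have pi_int : (lebesgue R p).-integrable Theta (EFin \o pi).
  apply/integrableP; split; first exact/measurable_EFinP.
  rewrite (eq_integral (fun theta => (pi theta)%:E)) ?pi1 ?ltry//.
  by move=> theta /set_mem Tt; rewrite /= ger0_norm// pi0.
have key z theta : X z -> Theta theta -> exists2 D : R,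
    PIF_quotient n X Theta P pi w S z theta (empirical y) e @[e --> 0^'+] -->
      D &
    `|D| <= C1 * pi theta.
  move=> zX Tt.
  have pi1' : \int[lebesgue R p]_(t in Theta) pi t = 1.
    by rewrite /Rintegral pi1.
  have ma : measurable_fun Theta (fun t => w * n%:R * mean_score t).
    exact: measurable_funM.
  have mb : measurable_fun Theta (path_exponent z).
    by apply: measurable_funM => //; apply: measurable_funB => //; exact: mS.
  have a_itv t : Theta t ->
      w * n%:R * lo <= w * n%:R * mean_score t <= w * n%:R * hi.
    by move=> Tt'; rewrite !ler_pM2l// mean_score_itv.
  have b_bnd t : Theta t -> `|path_exponent z t| <= w * n%:R * delta.
    exact: path_exponent_bnd.
  have [D Dcvg Dle] :=
    posterior_path_cvg mTheta pi0 pi_int pi1' ma mb a_itv b_bnd Tt.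
  exists D; last exact: Dle.
  (* The two quotients agree once [0 < e <= 1], which holds near [0] on the right. *)
  apply: cvg_trans Dcvg; apply: near_eq_cvg; near=> e.
  have e01 : 0 <= e <= 1.
    by apply/andP; split; [exact: ltW|near: e; exact: nbhs_right_le].
  have postE e' : 0 <= e' <= 1 ->
      posterior n X Theta P pi w S (contaminated e' (empirical y) z) theta =
      pi theta *
      expR (- (w * n%:R * mean_score theta + e' * path_exponent z theta)) /
      \int[lebesgue R p]_(t in Theta)
        (pi t * expR (- (w * n%:R * mean_score t + e' * path_exponent z t))).
    move=> e'01; rewrite /posterior (unnormalizedE zX Tt e'01); congr (_ / _).
    by apply: eq_Rintegral => t /set_mem Tt'; exact: unnormalizedE.
  by rewrite /PIF_quotient !postE ?lexx ?ler01.
have pi_le theta : Theta theta ->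
    pi theta <= fine (ereal_sup [set (pi theta)%:E | theta in Theta]).
  move=> Tt; have le_sup : ((pi theta)%:E <=
      ereal_sup [set (pi theta)%:E | theta in Theta])%E.
    by apply: ereal_sup_ubound; exists theta.
  rewrite -lee_fin fineK// fin_real// pi_bounded andbT.
  by rewrite (lt_le_trans _ le_sup)// ltNyr.
split.
  move=> z theta zX Tt; have [D Dcvg _] := key z theta zX Tt.
  by apply/cvg_ex; exists D.
apply: ge_ereal_sup => _ [z [theta [zX Tt ->]]].
have [D Dcvg Dle] := key z theta zX Tt.
rewrite lee_fin /PIF (cvg_lim _ Dcvg)// (le_trans Dle)// ler_wpM2l ?pi_le//.
have delta0 : 0 <= delta by rewrite (le_trans _ (S_dist Tt zX zX)).
by rewrite /C1 !mulr_ge0 ?expR_ge0 ?ler0n// ltW.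
Unshelve. all: by end_near. Qed.

End bounded_score.

(** * Kernel and energy scores *)

Section full_measure.
Context d (T : measurableType d) (R : realType).
Variables (P : probability T R) (X : set T).
Hypotheses (mX : measurable X) (PX : P X = 1%E).

(** The complement of [X] is null. This carries [power_distance_le], stated on the whole space, over
    to the energy score, whose integrals run over [X]. *)
Lemma Rintegral_full (f : T -> R) : P.-integrable setT (EFin \o f) ->
  \int[P]_x f x = \int[P]_(x in X) f x.
Proof.
move=> intf; rewrite /Rintegral; congr fine.
rewrite (negligible_integral (measurableC mX) measurableT intf); last first.
  by have := probability_setC P mX; rewrite PX subee.
by congr (integral P _ _); rewrite setTD setCK.
Qed.

Lemma product_probability_full : (P \x P)%E (X `*` X) = 1%E.
Proof.
by rewrite product_measure1E// [X in (X * _)%E]PX [X in (_ * X)%E]PX mule1.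
Qed.

Lemma measurable_fun_section (k : T -> T -> R) (y : T) : X y ->
  measurable_fun (X `*` X) (fun u => k u.1 u.2) ->
  measurable_fun X (k ^~ y).
Proof.
move=> Xy mk.
apply: (@measurable_comp _ _ _ _ _ _ (X `*` X) (fun u => k u.1 u.2) _
  (fun x => (x, y))) => //.
- exact: measurableX.
- by move=> _ [x Xx <-].
- exact/measurable_funTS/pair2_measurable.
Qed.

(** Fubini applied to the kernel extended by zero outside the square of [X], integrable because it
    is bounded. *)
Lemma measurable_fun_Rintegral (k : T -> T -> R) (M : R) :
  measurable_fun (X `*` X) (fun u => k u.1 u.2) ->
  (forall x y, X x -> X y -> `|k x y| <= M) ->
  measurable_fun X (fun y => \int[P]_(x in X) k x y).
Proof.
move=> mk kM; have mXX : measurable (X `*` X) by exact: measurableX.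
have PPfin : ((P \x P)%E (X `*` X) < +oo)%E.
  by rewrite product_probability_full ltry.
pose f := (EFin \o (fun u => k u.1 u.2)) \_ (X `*` X).
have intf : (P \x P)%E.-integrable setT f.
  apply/(integrable_mkcond _ mXX); apply: (bounded_integrable (M := M)) => //.
  by move=> [x y] [] /= Xx Xy; exact: kM.
have mG := measurable_fubini_G intf.
apply: (@eq_measurable_fun _ _ _ _ _ (fine \o fubini_G P f)).
  move=> y /set_mem Xy; rewrite /fubini_G/= /Rintegral [in RHS]integral_mkcond.
  congr fine; apply: eq_integral => x _.
  rewrite /f !patchE/= in_setX (mem_set Xy) andbT.
  by case: ifPn.
by apply: measurable_funTS; exact: measurableT_comp.
Qed.

End full_measure.

(** Positive definiteness at the two points with weights [1] and [s], for [s = 1] and [s = -1],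
    bounds twice the absolute value of [k x y] by [k x x + k y y]. *)
Lemma pd_kernel_bound (R : realType) d (X : set (euclidean R d))
    (k : euclidean R d -> euclidean R d -> R) (kappa : R) :
  pd_kernel X k -> (forall x, X x -> k x x <= kappa) ->
  forall x y, X x -> X y -> `|k x y| <= kappa.
Proof.
move=> [ksym kpd] kk x y Xx Xy.
have quad (s : R) : 0 <= k x x + s * k x y + (s * k y x + s * s * k y y).
  pose pt (i : 'I_2) := if i == ord0 then x else y.
  pose c (i : 'I_2) : R := if i == ord0 then 1 else s.
  have Xpt i : X (pt i) by rewrite /pt; case: ifP.
  have := kpd 2%N pt c Xpt.
  by rewrite !big_ord_recl !big_ord0/= /pt /c/= !addr0 !mul1r !mulr1.
have := quad 1; have := quad (-1); rewrite (ksym y x)//.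
have := kk _ Xx; have := kk _ Xy; rewrite ler_norml; lra.
Qed.

Section scores.
Context (R : realType) (d : nat) (X : set (euclidean R d)).
Variable P : probability (euclidean R d) R.
Hypotheses (mX : measurable X) (PX : P X = 1%E).

Section bounded_kernel.
Variables (k : euclidean R d -> euclidean R d -> R) (kappa : R).
Hypothesis mk : measurable_fun (X `*` X) (fun u => k u.1 u.2).
Hypothesis k_bnd : forall x y, X x -> X y -> `|k x y| <= kappa.

Lemma potential_bound y : X y -> `|\int[P]_(x in X) k x y| <= kappa.
Proof.
move=> Xy; apply: Rintegral_norm_le => //.
  exact: (measurable_fun_section mX Xy mk).
by move=> x Xx; exact: k_bnd.
Qed.

Lemma energy_bound : `|\int[(P \x P)%E]_(u in X `*` X) k u.1 u.2| <= kappa.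
Proof.
apply: (@Rintegral_norm_le _ _ R (P \x P)%E (X `*` X)) => //.
- exact: measurableX.
- exact: product_probability_full.
- by move=> u [Xu1 Xu2]; exact: k_bnd.
Qed.

End bounded_kernel.
End scores.

Lemma dist2xx (R : realType) d (x : euclidean R d) : dist2 x x = 0.
Proof.
by rewrite /dist2 big1 ?sqrtr0// => i _; rewrite subrr expr0n.
Qed.

(** On squared distances the exponent is [beta / 2], so [0 < beta < 2] becomes the range [0 < a < 1]
    of [power_distance_le]. *)
Lemma dist2_powR (R : realType) d (x y : euclidean R d) (beta : R) :
  dist2 x y `^ beta =
  (\sum_(i < d) (tnth x i - tnth y i : R) ^+ 2) `^ (beta / 2).
Proof.
rewrite /dist2 -powR12_sqrt; last by apply: sumr_ge0 => i _; exact: sqr_ge0.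
by rewrite -powRrM mulrC.
Qed.

Lemma coordinate_le_dist2 (R : realType) d (x y : euclidean R d) (i : 'I_d) :
  `|tnth x i - tnth y i : R| <= dist2 x y.
Proof.
rewrite -sqrtr_sqr ler_wsqrtr// (bigD1 i)//= lerDl.
by apply: sumr_ge0 => j _; exact: sqr_ge0.
Qed.

Lemma measurable_dist2_powR (R : realType) d (beta : R) :
  measurable_fun [set: euclidean R d * euclidean R d]
    (fun u => dist2 u.1 u.2 `^ beta).
Proof.
under eq_fun do rewrite dist2_powR.
apply: (measurableT_comp (f := @powR R ^~ (beta / 2))) => //.
apply: measurable_sum => i; apply: measurable_funX; apply: measurable_funB.
  exact: (measurableT_comp (measurable_tnth i)).
exact: (measurableT_comp (measurable_tnth i)).
Qed.

(** * Bounds and nonnegativity for the energy score *)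

Section energy.
Context (R : realType) (d : nat) (X : set (euclidean R d)).
Variable P : probability (euclidean R d) R.
Hypotheses (mX : measurable X) (PX : P X = 1%E).
Variables (beta B : R).
Hypothesis beta02 : 0 < beta < 2.
Hypothesis dist_le : forall x x', X x -> X x' -> dist2 x x' <= B.

Lemma dist2_powR_bound x y : X x -> X y -> `|dist2 x y `^ beta| <= B `^ beta.
Proof.
move=> Xx Xy; rewrite ger0_norm ?powR_ge0//.
have /andP[b0 _] := beta02.
have B0 : 0 <= B by rewrite -(dist2xx x) dist_le.
by rewrite ge0_ler_powR ?nnegrE ?sqrtr_ge0 ?dist_le// ltW.
Qed.

Lemma energy_score_ge0 y : X y -> 0 <= energy_score X beta P y.
Proof.
move=> Xy; rewrite /energy_score subr_ge0.
have mXX : measurable (X `*` X) by exact: measurableX.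
(* Coordinates are centred at [y], which cancels in differences, and set to zero off [X], which
   makes them bounded on the whole space. *)
pose phi (i : 'I_d) := (fun x : euclidean R d => tnth x i - tnth y i : R) \_ X.
have phiE i x : X x -> phi i x = tnth x i - tnth y i.
  by move=> Xx; rewrite /phi patchE mem_set.
have bphi i : bounded_mfun (phi i).
  split.
    apply/(measurable_restrictT _ mX).
    apply: (@measurable_funB _ _ R X (fun x => tnth x i : R)
      (fun=> tnth y i : R)) => //.
    exact: measurable_funTS (measurable_tnth i).
  exists B => x; rewrite /phi patchE; case: ifPn => [/set_mem Xx|_].
    by rewrite (le_trans (coordinate_le_dist2 _ _ _))// dist_le.
  by rewrite normr0 -(dist2xx y) dist_le.
have sum0 (I : finType) (f : I -> R) : 0 <= \sum_i f i ^+ 2.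
  by apply: sumr_ge0 => i _; exact: sqr_ge0.
have /andP[b0 b2] := beta02.
have b01 : 0 < beta / 2 < 1 by apply/andP; split; lra.
have b'0 : 0 <= beta / 2 by lra.
have intE1 : \int[(P \x P)%E]_(u in X `*` X) (dist2 u.1 u.2 `^ beta) =
    \int[(P \x P)%E]_(u in X `*` X)
      ((\sum_i (phi i u.1 - phi i u.2) ^+ 2) `^ (beta / 2)).
  apply: eq_Rintegral => -[x x'] /set_mem[/= Xx Xx']; rewrite dist2_powR.
  congr (_ `^ _); apply: eq_bigr => i _.
  by rewrite !phiE//; congr (_ ^+ _); ring.
have intE2 : \int[P]_(x in X) (dist2 x y `^ beta) =
    \int[P]_(x in X) ((\sum_i phi i x ^+ 2) `^ (beta / 2)).
  apply: eq_Rintegral => x /set_mem Xx; rewrite dist2_powR.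
  by congr (_ `^ _); apply: eq_bigr => i _; rewrite !phiE.
rewrite intE1 intE2.
have := @power_distance_le R _ _ P d phi (beta / 2) b01 bphi.
have bN : bounded_mfun (fun x => (\sum_i phi i x ^+ 2) `^ (beta / 2)).
  apply: bounded_mfun_powR b'0 (fun x => sum0 _ _) _.
  by apply: bounded_mfun_sum => i; exact: bounded_mfunX.
have bD : bounded_mfun (fun u : euclidean R d * euclidean R d =>
    (\sum_i (phi i u.1 - phi i u.2) ^+ 2) `^ (beta / 2)).
  apply: bounded_mfun_powR b'0 (fun x => sum0 _ _) _.
  apply: bounded_mfun_sum => i; apply/bounded_mfunX/bounded_mfunB.
    exact: bounded_mfun_fst.
  exact: bounded_mfun_snd.
rewrite (Rintegral_full mX PX (bounded_mfun_probability_integrable P bN)).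
rewrite (@Rintegral_full _ _ _ (P \x P)%E (X `*` X) mXX
  (product_probability_full mX PX) _
  (bounded_mfun_probability_integrable (P \x P)%E bD)).
exact.
Qed.

End energy.

(** A density of mass one forces [Theta] to be nonempty, which excludes the value [-oo] of an empty
    supremum. *)
Lemma density_sup_fin_num (R : realType) (p : nat)
    (Theta : set (euclidean R p)) (pi : euclidean R p -> R) :
  prob_density Theta pi ->
  (ereal_sup [set (pi theta)%:E | theta in Theta] < +oo)%E ->
  exists2 M : R, 0 <= M &
    ereal_sup [set (pi theta)%:E | theta in Theta] = M%:E.
Proof.
move=> [_ pi0 pi1] sup_lty.
case: (eqVneq Theta set0) => [T0|/set0P[theta Tt]].
  by move: pi1; rewrite T0 integral_set0 => /eqP; rewrite eqe eq_sym oner_eq0.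
have le_sup :
    ((pi theta)%:E <= ereal_sup [set (pi theta)%:E | theta in Theta])%E.
  by apply: ereal_sup_ubound; exists theta.
move: sup_lty le_sup; case: ereal_sup => // M _; rewrite lee_fin => piM.
by exists M => //; exact: le_trans (pi0 _ Tt) piM.
Qed.

(** Having both values in the same interval saves the factor 2 that the triangle inequality would
    cost. *)
Lemma dist_le_of_itv (R : realDomainType) (x y K : R) :
  0 <= x <= K -> 0 <= y <= K -> `|x - y| <= K.
Proof. by rewrite ler_norml; lra. Qed.

Theorem theorem4 (R : realType) (d p n : nat)
    (X : set (euclidean R d)) (Theta : set (euclidean R p))
    (P : euclidean R p -> probability (euclidean R d) R)
    (pi : euclidean R p -> R) (y : n.-tuple (euclidean R d)) (w : R)
    (mX : measurable X) (mTheta : measurable Theta)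
    (P_on_X : forall theta, Theta theta -> P theta X = 1%E)
    (pi_density : prob_density Theta pi)
    (pi_bounded : (ereal_sup [set (pi theta)%:E | theta in Theta] < +oo)%E)
    (n_gt0 : (0 < n)%N)
    (y_in_X : forall i, X (tnth y i))
    (w_gt0 : 0 < w) :
  (forall (k : euclidean R d -> euclidean R d -> R) (kappa : R),
     pd_kernel X k ->
     measurable_fun (X `*` X) (fun u => k u.1 u.2) ->
     measurable_score X Theta P (kernel_score X k) ->
     (forall x, X x -> k x x <= kappa) ->
     exists C : R,
       globally_bias_robust X Theta P pi w (kernel_score X k) y C /\
       (C%:E <= (8 * w * n%:R * kappa * expR (6 * w * n%:R * kappa))%:E
                * ereal_sup [set (pi theta)%:E | theta in Theta])%E) /\
  (forall (beta B : R),
     0 < beta < 2 ->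
     measurable_score X Theta P (energy_score X beta) ->
     (forall x x', X x -> X x' -> dist2 x x' <= B) ->
     exists C : R,
       globally_bias_robust X Theta P pi w (energy_score X beta) y C /\
       (C%:E <= (8 * w * n%:R * (B `^ beta) *
                   expR (2 * w * n%:R * (B `^ beta)))%:E
                * ereal_sup [set (pi theta)%:E | theta in Theta])%E).
Proof.
have [M M0 supM] := density_sup_fin_num pi_density pi_bounded.
have wn0 : 0 <= w * n%:R by rewrite mulr_ge0 ?ler0n// ltW.
split.
  move=> k kappa kpd mk mS kk.
  have k_bnd := pd_kernel_bound kpd kk.
  (* Both expectations in the score are at most [kappa] in absolute value, so the score is within
     [3 * kappa] of zero. Only the doubled one depends on [y], so the score varies by at most
     [4 * kappa]. *)
  have robust := @bounded_score_bias_robust R d p n X Theta P pi y w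
    (kernel_score X k) (- (3 * kappa)) (3 * kappa) (4 * kappa) mX mTheta
    pi_density pi_bounded n_gt0 y_in_X w_gt0 mS.
  eexists; split; first apply: robust.
  - move=> theta Tt; apply: measurable_funB => //; apply: measurable_funM => //.
    exact: (measurable_fun_Rintegral mX (P_on_X _ Tt) mk k_bnd).
  - move=> theta x Tt Xx.
    have := energy_bound mX (P_on_X _ Tt) mk k_bnd.
    have := potential_bound mX (P_on_X _ Tt) mk k_bnd Xx.
    rewrite !ler_norml /kernel_score; lra.
  - move=> theta x x' Tt Xx Xx'.
    have := potential_bound mX (P_on_X _ Tt) mk k_bnd Xx.
    have := potential_bound mX (P_on_X _ Tt) mk k_bnd Xx'.
    rewrite !ler_norml /kernel_score; lra.
  rewrite supM /= -EFinM lee_fin le_eqVlt; apply/orP; left; apply/eqP.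
  by congr (_ * expR _ * _); ring.
move=> beta B beta02 mS dist_le.
have mk : measurable_fun (X `*` X) (fun u => dist2 u.1 u.2 `^ beta).
  by apply: measurable_funTS; exact: measurable_dist2_powR.
have k_bnd := dist2_powR_bound beta02 dist_le.
(* The lower end [0] is [energy_score_ge0]; the upper end comes from dropping the subtracted pair
   expectation. That expectation cancels between two observation points, and the remaining ones lie
   in an interval of length [B ^ beta], whence the oscillation bound. *)
have robust := @bounded_score_bias_robust R d p n X Theta P pi y w
  (energy_score X beta) 0 (2 * B `^ beta) (2 * B `^ beta) mX mTheta
  pi_density pi_bounded n_gt0 y_in_X w_gt0 mS.
have energy0 theta :
    0 <= \int[(P theta \x P theta)%E]_(u in X `*` X) (dist2 u.1 u.2 `^ beta).
  by apply: Rintegral_ge0 => u _; exact: powR_ge0.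
have potential0 theta x : 0 <= \int[P theta]_(x' in X) (dist2 x' x `^ beta).
  by apply: Rintegral_ge0 => u _; exact: powR_ge0.
eexists; split; first apply: robust.
- move=> theta Tt; apply: measurable_funB => //; apply: measurable_funM => //.
  exact: (measurable_fun_Rintegral mX (P_on_X _ Tt) mk k_bnd).
- move=> theta x Tt Xx.
  rewrite (energy_score_ge0 mX (P_on_X _ Tt) beta02 dist_le Xx).
  rewrite /= /energy_score lerBlDr ler_wpDr ?energy0// ler_pM2l//.
  exact: le_trans (ler_norm _) (potential_bound mX (P_on_X _ Tt) mk k_bnd Xx).
- move=> theta x x' Tt Xx Xx'.
  rewrite /energy_score opprB addrA subrK -mulrBr normrM gtr0_norm//.
  rewrite ler_pM2l//; apply: dist_le_of_itv; rewrite potential0.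
    exact: le_trans (ler_norm _) (potential_bound mX (P_on_X _ Tt) mk k_bnd Xx).
  exact: le_trans (ler_norm _) (potential_bound mX (P_on_X _ Tt) mk k_bnd Xx').
rewrite supM /= -EFinM lee_fin ler_wpM2r// mulr0 subr0.
rewrite (_ : w * n%:R * (2 * B `^ beta) = 2 * w * n%:R * (B `^ beta));
  last by ring.
(* The prefactor obtained is [4 * w * n%:R * B ^ beta], half of the one claimed. *)
rewrite ler_wpM2r ?expR_ge0//.
have := mulr_ge0 wn0 (powR_ge0 B beta); lra.
Qed.
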